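(* Let $\mathbf{k}$ be a field of characteristic zero and $\lambda\in\mathbf{k}$ nonzero. Let $(\mathfrak{g},\cdot,R)$ be a commutative (associative) modified Rota-Baxter algebra of weight $\lambda$ over $\mathbf{k}$, let $D$ be a derivation of $(\mathfrak{g},\cdot)$ with $D\circ R=R\circ D$, and let $f\in\mathfrak{g}^*$ satisfy $f(D(x)\cdot y)=f(x\cdot D(y))$ for all $x,y\in\mathfrak{g}$. Then $R$ is a modified Rota-Baxter operator of weight $\lambda$ on the $3$-Lie algebra $(\mathfrak{g},\{\cdot,\cdot,\cdot\}_{f,D})$, where $$\{x,y,z\}_{f,D}=\left|\begin{array}{ccc} f(x) & f(y) & f(z) \\ D(x) & D(y) & D(z) \\ x & y & z \end{array}\right|,$$ if and only if for all $x,y,z\in\mathfrak{g}$ \begin{align*} &R\Big(f(x)(DRy\cdot Rz-DRz\cdot Ry)+f(y)(DRz\cdot Rx-DRx\cdot Rz)+f(z)(DRx\cdot Ry-DRy\cdot Rx)\\ &\quad+\lambda f(x)(Dy\cdot z-Dz\cdot y)+\lambda f(y)(Dz\cdot x-Dx\cdot z)+\lambda f(z)(Dx\cdot y-Dy\cdot x)\Big)\\ &-\lambda f(x)(DRy\cdot z-Dz\cdot Ry)-\lambda f(x)(Dy\cdot Rz-DRz\cdot y)-\lambda f(y)(DRz\cdot x-Dx\cdot Rz)\\ &-\lambda f(y)(Dz\cdot Rx-DRx\cdot z)-\lambda f(z)(DRx\cdot y-Dy\cdot Rx)-\lambda f(z)(Dx\cdot Ry-DRy\cdot x)\\ &-2\lambda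 f(Ry)(Dz\cdot x-Dx\cdot z)-2\lambda f(Rx)(Dy\cdot z-Dz\cdot y)-2\lambda f(Rz)(Dx\cdot y-Dy\cdot x)=0. \end{align*}
   Context: A commutative modified Rota-Baxter algebra of weight $\lambda$ is a commutative associative algebra $(\mathfrak{g},\cdot)$ with a linear map $R$ satisfying $R(x)\cdot R(y)=R(R(x)\cdot y+x\cdot R(y))+\lambda\,x\cdot y$ for all $x,y$. The determinant is expanded along its first row: $\{x,y,z\}_{f,D}=f(x)(Dy\cdot z-Dz\cdot y)+f(y)(Dz\cdot x-Dx\cdot z)+f(z)(Dx\cdot y-Dy\cdot x)$; it is known to be a $3$-Lie bracket under the hypothesis on $f$. A $3$-Lie algebra is a vector space with a skew-symmetric trilinear bracket satisfying $[x,y,[u,v,w]]=[[x,y,u],v,w]+[u,[x,y,v],w]+[u,v,[x,y,w]]$. A modified Rota-Baxter operator of weight $\lambda$ on a $3$-Lie algebra $(\mathfrak{g},[\cdot,\cdot,\cdot])$ is a linear map $R:\mathfrak{g}\to\mathfrak{g}$ such that for all $x,y,z$ $$[Rx,Ry,Rz]=R\big([Rx,Ry,z]+[x,Ry,Rz]+[Rx,y,Rz]+\lambda[x,y,z]\big)-\lambda[Rx,y,z]-\lambda[x,Ry,z]-\lambda[x,y,Rz].$$ *)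

(* Defs.v *)
From mathcomp Require Import all_boot all_order all_algebra.

Set Implicit Arguments.
Unset Strict Implicit.
Unset Printing Implicit Defensive.

Import GRing.Theory.
Local Open Scope ring_scope.

(* Algebras are not assumed to be unital and may be infinite-dimensional: the
   product is a bilinear map on an arbitrary vector space, not a MathComp ring
   structure. *)
Notation "x *[ m ] y" := (m x y)
  (at level 40, m at level 200, left associativity,
   format "x  *[ m ]  y") : ring_scope.

Section CommutativeAlgebras.
Variables (k : fieldType) (g : lmodType k) (mul : {bilinear g -> g -> g}).

Record comm_assoc_algebra : Prop := CommAssocAlgebra {
  comm_assoc_algebraC : commutative mul;
  comm_assoc_algebraA : associative mul }.

Record comm_modified_RB_algebra (lambda : k) (R : {linear g -> g}) : Prop :=
  CommModifiedRBAlgebra {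
    modified_RB_comm_assoc : comm_assoc_algebra;
    modified_RB_eq : forall x y : g,
      R x *[mul] R y = R (R x *[mul] y + x *[mul] R y)
                       + lambda *: (x *[mul] y) }.

Definition derivation (D : {linear g -> g}) : Prop :=
  forall x y : g, D (x *[mul] y) = D x *[mul] y + x *[mul] D y.

(* The determinant with rows (f x, f y, f z), (D x, D y, D z), (x, y, z),
   expanded along its first row. *)
Definition det_bracket (f : {scalar g}) (D : {linear g -> g}) (x y z : g) : g :=
  f x *: (D y *[mul] z - D z *[mul] y)
  + f y *: (D z *[mul] x - D x *[mul] z)
  + f z *: (D x *[mul] y - D y *[mul] x).

End CommutativeAlgebras.

Section ThreeLie.
Variables (k : fieldType) (g : lmodType k) (br : g -> g -> g -> g).

Definition trilinear : Prop :=
  [/\ forall y z : g, linear (fun x => br x y z),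
      forall x z : g, linear (fun y => br x y z)
    & forall x y : g, linear (fun z => br x y z)].

(* Sign change under the two adjacent transpositions, which generate 'S_3. *)
Definition skew_symmetric3 : Prop :=
  forall x y z : g, br y x z = - br x y z /\ br x z y = - br x y z.

Record three_Lie_algebra : Prop := ThreeLieAlgebra {
  three_Lie_trilinear : trilinear;
  three_Lie_skew : skew_symmetric3;
  three_Lie_fundamental : forall x y u v w : g,
    br x y (br u v w) =
    br (br x y u) v w + br u (br x y v) w + br u v (br x y w) }.

(* Being a modified Rota-Baxter operator on a 3-Lie algebra includes that the
   underlying bracket is a 3-Lie bracket. *)
Record modified_RB_operator_3Lie (lambda : k) (R : {linear g -> g}) : Prop :=
  ModifiedRBOperator3Lie {
    modified_RB_3Lie_algebra : three_Lie_algebra;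
    modified_RB_3Lie_eq : forall x y z : g,
      br (R x) (R y) (R z) =
      R (br (R x) (R y) z + br x (R y) (R z) + br (R x) y (R z)
         + lambda *: br x y z)
      - lambda *: br (R x) y z - lambda *: br x (R y) z
      - lambda *: br x y (R z) }.

End ThreeLie.

(* Main.v *)
Require Import Defs.
From HB Require Import structures.
From mathcomp Require Import all_boot all_order all_algebra.

Import GRing.Theory.
Local Open Scope ring_scope.

(** Write [B x y = D x . y - D y . x]. It is a Lie bracket, and the hypothesis on
    [f] says that [f] vanishes on its values. For any such "trace" [f] on a Lie
    algebra, [f x B(y,z) + f y B(z,x) + f z B(x,y)] is a 3-Lie bracket. Since [R]
    commutes with [D], it satisfies
    [B (R x) (R y) = R (B (R x) y + B x (R y)) + lambda B x y], and substituting
    this in the terms of the operator identity that carry a factor [f (R _)]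
    turns it into the stated condition. *)

Section TraceBracket.
Context {k : fieldType} {g : lmodType k}.
Variables (B : {bilinear g -> g -> g}) (f : {scalar g}).

Definition trace_bracket (x y z : g) : g :=
  f x *: B y z + f y *: B z x + f z *: B x y.

(** Linearity and skew-symmetry need a direct check in one position only; this rotation carries them
    to the others. *)
Lemma trace_bracketC x y z : trace_bracket x y z = trace_bracket y z x.
Proof. by rewrite /trace_bracket -addrA addrC. Qed.

Lemma trace_bracketPl a x x' y z :
  trace_bracket (a *: x + x') y z
  = a *: trace_bracket x y z + trace_bracket x' y z.
Proof.
rewrite /trace_bracket linearP linearPr linearPl /=.
rewrite scalerDl !scalerDr !scalerA ![f _ * a]mulrC.
by rewrite (AC (2*2*2) ((1*3*5)*(2*4*6))).
Qed.

Lemma trace_bracket_trilinear : trilinear trace_bracket.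
Proof.
split=> [y z a x x'|x z a y y'|x y a z z']; first exact: trace_bracketPl.
  by rewrite 3!(trace_bracketC x) trace_bracketPl.
by rewrite -3!(trace_bracketC _ x y) trace_bracketPl.
Qed.

Lemma trace_bracketDl x x' y z :
  trace_bracket (x + x') y z = trace_bracket x y z + trace_bracket x' y z.
Proof. by have := trace_bracketPl 1 x x' y z; rewrite !scale1r. Qed.

Lemma trace_bracketDm x y y' z :
  trace_bracket x (y + y') z = trace_bracket x y z + trace_bracket x y' z.
Proof. by rewrite 3!(trace_bracketC x) trace_bracketDl. Qed.

Lemma trace_bracketDr x y z z' :
  trace_bracket x y (z + z') = trace_bracket x y z + trace_bracket x y z'.
Proof. by rewrite -3!(trace_bracketC _ x y) trace_bracketDl. Qed.

(** Eliminating [R] of mixed terms turns the right side of the operator identity into its left side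
    plus the left side of the condition. *)
Lemma trace_bracket_modified_RB (lambda : k) (R : {linear g -> g}) :
  (forall x y, B (R x) (R y) = R (B (R x) y + B x (R y)) + lambda *: B x y) ->
  forall x y z,
  trace_bracket (R x) (R y) (R z) =
    R (trace_bracket (R x) (R y) z + trace_bracket x (R y) (R z)
       + trace_bracket (R x) y (R z) + lambda *: trace_bracket x y z)
    - lambda *: trace_bracket (R x) y z - lambda *: trace_bracket x (R y) z
    - lambda *: trace_bracket x y (R z)
  <->
  R (f x *: B (R y) (R z) + f y *: B (R z) (R x) + f z *: B (R x) (R y)
     + (lambda * f x) *: B y z + (lambda * f y) *: B z x
     + (lambda * f z) *: B x y)
  - (lambda * f x) *: B (R y) z - (lambda * f x) *: B y (R z)
  - (lambda * f y) *: B (R z) x - (lambda * f y) *: B z (R x)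
  - (lambda * f z) *: B (R x) y - (lambda * f z) *: B x (R y)
  - (2%:R * lambda * f (R y)) *: B z x
  - (2%:R * lambda * f (R x)) *: B y z
  - (2%:R * lambda * f (R z)) *: B x y = 0.
Proof.
move=> RB x y z.
have {}RB u v : R (B (R u) v + B u (R v)) = B (R u) (R v) - lambda *: B u v.
  by rewrite RB addrK.
set U := trace_bracket (R x) (R y) (R z).
(* Terms are sorted by where [R] acts: on both arguments of [B] in [S], on exactly one in [T], only
   inside [f] in [P]. *)
pose S := f x *: B (R y) (R z) + f y *: B (R z) (R x) + f z *: B (R x) (R y).
pose T := f x *: (B (R y) z + B y (R z)) + f y *: (B (R z) x + B z (R x))
  + f z *: (B (R x) y + B x (R y)).
pose P := f (R y) *: B z x + f (R x) *: B y z + f (R z) *: B x y.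
have one_R : trace_bracket (R x) y z + (trace_bracket x (R y) z
    + trace_bracket x y (R z)) = P + T.
  rewrite /trace_bracket /T !scalerDr.
  by rewrite (AC (3*(3*3)) ((5*1*9)*((4*7)*(8*2)*(3*6)))).
(* Terms with one [R] inside [f] and one inside [B] pair up into [B (R u) v + B u (R v)], where [RB]
   applies; this recovers [U] up to [lambda *: P]. *)
have two_R : R (trace_bracket (R x) (R y) z + trace_bracket x (R y) (R z)
    + trace_bracket (R x) y (R z)) = R S + (U - lambda *: P).
  have -> : trace_bracket (R x) (R y) z + trace_bracket x (R y) (R z)
      + trace_bracket (R x) y (R z)
    = S + (f (R y) *: (B (R z) x + B z (R x))
        + f (R x) *: (B (R y) z + B y (R z))
        + f (R z) *: (B (R x) y + B x (R y))).
    rewrite /trace_bracket !scalerDr.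
    by rewrite (AC (3*3*3) ((4*8*3)*((5*2)*(1*7)*(9*6)))).
  rewrite linearD; congr (_ + _).
  rewrite 2!linearD ![R (_ *: _)]linearZ /= !RB !scalerBr.
  rewrite (AC (2*2*2) ((3*1*5)*(2*4*6))) /= -!opprD.
  by rewrite /P !scalerDr !scalerA ![_ * lambda]mulrC.
(* The coefficient of [P] collects one [lambda] from [one_R] and one from [two_R]. *)
have -> : R (trace_bracket (R x) (R y) z + trace_bracket x (R y) (R z)
       + trace_bracket (R x) y (R z) + lambda *: trace_bracket x y z)
    - lambda *: trace_bracket (R x) y z - lambda *: trace_bracket x (R y) z
    - lambda *: trace_bracket x y (R z)
  = U + (R (S + lambda *: trace_bracket x y z)
         - lambda *: T - (2%:R * lambda) *: P).
  rewrite -2!addrA -!opprD -!scalerDr one_R (linearD R) two_R (linearD R S).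
  rewrite -scalerA scaler_nat mulr2n [lambda *: (P + T)]scalerDr !opprD.
  by rewrite (AC (1*2*1*2) (2*((1*4*6)*(3*5)))).
set W := (X in _ <-> X = 0).
have <- : W = R (S + lambda *: trace_bracket x y z)
    - lambda *: T - (2%:R * lambda) *: P.
  by rewrite /T /P /trace_bracket !(scalerDr, scalerA, opprD, addrA).
by split=> [UW|->]; [apply: (addrI U); rewrite addr0 | rewrite addr0].
Qed.

Hypothesis B_skew : forall x y, B y x = - B x y.

Lemma trace_bracket_skew : skew_symmetric3 trace_bracket.
Proof.
have skew x y z : trace_bracket y x z = - trace_bracket x y z.
  rewrite /trace_bracket (B_skew z x) (B_skew y z) (B_skew x y).
  by rewrite !scalerN !opprD (addrC (- (f y *: _))).
by move=> x y z; split=> //; rewrite trace_bracketC skew -trace_bracketC.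
Qed.

(** Terms where [E] enters [f] vanish; the other six pair up by the Leibniz rule for [B]. *)
Lemma trace_bracket_derivation (E : {linear g -> g}) :
  (forall x, f (E x) = 0) ->
  (forall x y, E (B x y) = B (E x) y + B x (E y)) ->
  forall u v w, E (trace_bracket u v w) =
    trace_bracket (E u) v w + trace_bracket u (E v) w + trace_bracket u v (E w).
Proof.
move=> fE EB u v w; rewrite /trace_bracket !linearD !linearZ /= !EB !fE.
rewrite !scale0r add0r addr0 addr0 !scalerDr.
by rewrite (AC (2*2*2) ((4*5)*(1*6)*(2*3))).
Qed.

(** The rank-one map [f _ *: c] acts on each argument in turn: terms with [c] inside [f] rebuild the
    bracket, those with [c] inside [B] cancel in pairs by skew-symmetry. *)
Lemma trace_bracket_shift c u v w :
  trace_bracket (f u *: c) v w + trace_bracket u (f v *: c) w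
  + trace_bracket u v (f w *: c) = f c *: trace_bracket u v w.
Proof.
rewrite /trace_bracket !linearZ /= !linearZl_LR.
rewrite (B_skew c w) (B_skew c u) (B_skew v c) !scalerN !scalerDr !scalerA.
rewrite ![_ * f c]mulrC.
rewrite (AC ((3*3)*3) ((1*5*9)*(2*4)*(6*8)*(3*7))) /= !addNr.
by rewrite !addr0.
Qed.

Hypothesis B_leibniz :
  forall x y z, B x (B y z) = B (B x y) z + B y (B x z).
Hypothesis f_trace : forall x y, f (B x y) = 0.

(* [trace_bracket x y] is the derivation [E = f x B(y,_) - f y B(x,_)] of [B],
   whose values are killed by [f], plus the rank-one map [f _ *: B x y], whose
   contributions add up to [f (B x y) *: trace_bracket u v w = 0]. *)
Lemma trace_bracket_three_Lie : three_Lie_algebra trace_bracket.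
Proof.
split; [exact: trace_bracket_trilinear | exact: trace_bracket_skew |].
move=> x y u v w.
pose E : {linear g -> g} := (f x \*: B y \- f y \*: B x)%R.
have EE t : E t = f x *: B y t - f y *: B x t by [].
have tbE t : trace_bracket x y t = E t + f t *: B x y.
  by rewrite EE /trace_bracket (B_skew x t) scalerN.
have fE t : f (E t) = 0 by rewrite EE linearB !linearZ /= !f_trace !mulr0 subr0.
have EB s t : E (B s t) = B (E s) t + B s (E t).
  rewrite !EE (B_leibniz x) (B_leibniz y) linearBl linearBr !linearZl_LR.
  by rewrite !linearZr_LR !scalerDr opprD addrACA.
(* Hence the rank-one part of [trace_bracket x y] contributes nothing to the left side. *)
have f_tb : f (trace_bracket u v w) = 0.
  by rewrite /trace_bracket !linearD !linearZ /= !f_trace !mulr0 !addr0.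
rewrite !tbE f_tb scale0r addr0 trace_bracketDl trace_bracketDm trace_bracketDr.
rewrite (AC (2*2*2) ((1*3*5)*(2*4*6))) /= trace_bracket_shift f_trace scale0r.
by rewrite addr0; exact: (trace_bracket_derivation E fE EB).
Qed.

End TraceBracket.

Section DerivationBracket.
Context {k : fieldType} {g : lmodType k}.
Variables (mul : {bilinear g -> g -> g}) (D : {linear g -> g}).

(** For commutative [mul] this is, up to sign, the Wronskian of [x] and [y]. *)
Definition der_bracket (x y : g) : g := D x *[mul] y - D y *[mul] x.

Lemma der_bracket_skew x y : der_bracket y x = - der_bracket x y.
Proof. by rewrite /der_bracket opprB. Qed.

Lemma der_bracket_linearr x : linear (der_bracket x).
Proof.
move=> a y z; rewrite /der_bracket linearP linearPr linearPl.
by rewrite scalerBr opprD addrACA.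
Qed.

Lemma der_bracket_bilinear : bilinear_for *:%R *:%R der_bracket.
Proof.
split=> [y a x x'|]; last exact: der_bracket_linearr.
rewrite !(der_bracket_skew y) der_bracket_linearr.
by rewrite /= scalerN opprD.
Qed.

HB.instance Definition _ :=
  bilinear_isBilinear.Build k g g g *:%R *:%R der_bracket der_bracket_bilinear.

Hypotheses (mul_comm_assoc : comm_assoc_algebra mul) (D_der : derivation mul D).

(** Each nested bracket reduces to four monomials. On the right those in [D y *[mul] D z *[mul] x]
    and [D (D x) *[mul] y *[mul] z] cancel, and the rest is the expansion of the left. *)
Lemma der_bracket_leibniz x y z :
  der_bracket x (der_bracket y z)
  = der_bracket (der_bracket x y) z + der_bracket y (der_bracket x z).
Proof.
have [mulC mulA] := mul_comm_assoc.
have mulAC a b c : a *[mul] b *[mul] c = a *[mul] c *[mul] b.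
  by rewrite -!mulA [b *[mul] c]mulC.
have bb a b c : der_bracket a (der_bracket b c)
    = D a *[mul] D b *[mul] c - D a *[mul] D c *[mul] b
      + D (D c) *[mul] a *[mul] b - D (D b) *[mul] a *[mul] c.
  rewrite /der_bracket [D (_ - _)]linearB /= !D_der linearBr !(linearBl, linearDl) !mulA.
  rewrite opprB (mulC (D c) (D b)) opprD [X in _ + X]addrACA subrr addr0 addrA.
  by rewrite (mulAC _ b a) (mulAC _ c a).
rewrite (der_bracket_skew z (der_bracket x y)) !bb.
rewrite !(mulC (D z)) (mulC (D y) (D x)).
rewrite (mulAC _ y x) (mulAC _ z x) (mulAC _ z y) !opprD !opprK.
by rewrite [RHS](AC (4*4) (5*1*7*3*(2*6)*(4*8))) /= !subrr !addr0.
Qed.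

Lemma scalar_der_bracket (f : {scalar g}) :
  (forall x y, f (D x *[mul] y) = f (x *[mul] D y)) ->
  forall x y, f (der_bracket x y) = 0.
Proof.
move=> fD x y; have [mulC _] := mul_comm_assoc.
by rewrite linearB /= fD mulC subrr.
Qed.

Lemma det_bracket_three_Lie (f : {scalar g}) :
  (forall x y, f (D x *[mul] y) = f (x *[mul] D y)) ->
  three_Lie_algebra (det_bracket mul f D).
Proof.
(* [det_bracket mul f D] unfolds to the trace bracket of [der_bracket]. *)
move=> fD; apply: (trace_bracket_three_Lie der_bracket).
- exact: der_bracket_skew.
- exact: der_bracket_leibniz.
- exact: scalar_der_bracket.
Qed.

(** As [D] commutes with [R], the Rota-Baxter identity applies to [R (D x) *[mul] R y] and to [R (D
    y) *[mul] R x]; the claim is the difference of the two instances. *)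
Lemma der_bracket_modified_RB (lambda : k) (R : {linear g -> g}) :
  comm_modified_RB_algebra mul lambda R -> (forall x, D (R x) = R (D x)) ->
  forall x y, der_bracket (R x) (R y)
    = R (der_bracket (R x) y + der_bracket x (R y)) + lambda *: der_bracket x y.
Proof.
move=> [_ RB] DR x y.
rewrite /der_bracket !DR !RB scalerBr opprD addrACA -linearB /=.
by rewrite [R (D y) *[mul] x + _]addrC opprD addrACA.
Qed.

End DerivationBracket.

Theorem theorem4p10 (k : fieldType) (hchar : [pchar k] =i pred0)
  (lambda : k) (hlambda : lambda != 0)
  (g : lmodType k) (mul : {bilinear g -> g -> g}) (R : {linear g -> g})
  (hR : comm_modified_RB_algebra mul lambda R)
  (D : {linear g -> g}) (hD : derivation mul D)
  (hDR : forall x : g, D (R x) = R (D x))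
  (f : {scalar g})
  (hf : forall x y : g, f (D x *[mul] y) = f (x *[mul] D y)) :
  modified_RB_operator_3Lie (det_bracket mul f D) lambda R
  <->
  (forall x y z : g,
     R (f x *: (D (R y) *[mul] R z - D (R z) *[mul] R y)
        + f y *: (D (R z) *[mul] R x - D (R x) *[mul] R z)
        + f z *: (D (R x) *[mul] R y - D (R y) *[mul] R x)
        + (lambda * f x) *: (D y *[mul] z - D z *[mul] y)
        + (lambda * f y) *: (D z *[mul] x - D x *[mul] z)
        + (lambda * f z) *: (D x *[mul] y - D y *[mul] x))
     - (lambda * f x) *: (D (R y) *[mul] z - D z *[mul] R y)
     - (lambda * f x) *: (D y *[mul] R z - D (R z) *[mul] y)
     - (lambda * f y) *: (D (R z) *[mul] x - D x *[mul] R z)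
     - (lambda * f y) *: (D z *[mul] R x - D (R x) *[mul] z)
     - (lambda * f z) *: (D (R x) *[mul] y - D y *[mul] R x)
     - (lambda * f z) *: (D x *[mul] R y - D (R y) *[mul] x)
     - (2%:R * lambda * f (R y)) *: (D z *[mul] x - D x *[mul] z)
     - (2%:R * lambda * f (R x)) *: (D y *[mul] z - D z *[mul] y)
     - (2%:R * lambda * f (R z)) *: (D x *[mul] y - D y *[mul] x) = 0).
Proof.
have [mul_comm_assoc _] := hR.
(* Up to unfolding [der_bracket], this is the desired equivalence at fixed arguments. *)
have condE x y z := trace_bracket_modified_RB (der_bracket mul D) f lambda R
  (der_bracket_modified_RB mul D lambda R hR hDR) x y z.
split=> [[_ RBbr] x y z|cond]; first exact/condE/RBbr.
split=> [|x y z]; first exact: det_bracket_three_Lie.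
exact/condE/cond.
Qed.
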